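(* For any positive integer $N$, as $n\to\infty$, \begin{equation*} \mathrm{spt}(n, N) = \frac{n^N}{(N!)^2} + O(n^{N-1}). \end{equation*}
   Context: $\mathrm{spt}(n,N)$ is the total number of occurrences of the smallest part, summed over all partitions of $n$ whose largest part is $\leq N$. *)

(* Defs.v *)
From mathcomp Require Import all_boot all_order all_algebra.
From mathcomp Require Import all_classical all_reals all_analysis.

Set Implicit Arguments.
Unset Strict Implicit.
Unset Printing Implicit Defensive.

Local Open Scope nat_scope.

(* Parts are listed in weakly decreasing order. *)
Definition is_partition (n : nat) (s : seq nat) : bool :=
  [&& sorted geq s, all (fun i => 0 < i) s & sumn s == n].

(* The last part of a partition is the smallest one. *)
Definition smallest_part (s : seq nat) : nat := last 0 s.

(* A partition of n has at most n parts, each at most n, so the finite type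
   n.-bseq 'I_n.+1 contains all of them (is_partition_bseq below). *)
Definition partitions_le (n N : nat) : {set n.-bseq 'I_n.+1} :=
  [set p : n.-bseq 'I_n.+1 | is_partition n (map val p) &
                             all (fun i : 'I_n.+1 => i <= N) p].

Definition spt (n N : nat) : nat :=
  \sum_(p in partitions_le n N)
    count_mem (smallest_part (map val p)) (map val p).

Lemma is_partition_bseq (n : nat) (s : seq nat) :
  is_partition n s -> exists p : n.-bseq 'I_n.+1, map val p = s.
Proof.
case/and3P=> _ pos_s /eqP sum_s.
have size_s : size s <= n.
  rewrite -sum_s; elim: s pos_s {sum_s} => //= i s IHs /andP[i_gt0 /IHs le_s].
  by rewrite -add1n leq_add.
have map_s : map val (map (@inord n) s) = s.
  rewrite -map_comp; apply: map_id_in => i s_i /=; rewrite inordK// ltnS -sum_s.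
  elim: s s_i {pos_s sum_s size_s} => //= j s IHs; rewrite inE.
  by case/predU1P=> [->|/IHs /leq_trans-> //]; rewrite ?leq_addr ?leq_addl.
have size_p : size (map (@inord n) s) <= n by rewrite size_map.
by exists (Bseq size_p).
Qed.

(* Main.v *)
Require Import Defs.
From mathcomp Require Import all_boot all_order all_algebra.
From mathcomp Require Import all_classical all_reals all_analysis.
From mathcomp Require Import zify ring lra.
Import Order.TTheory GRing.Theory Num.Theory.
Import numFieldNormedType.Exports.
Local Open Scope classical_set_scope.
Local Open Scope ring_scope.

(* Splitting off the m parts equal to the largest allowed size d = N + 1 gives
     spt(n, d) = sum_(0 <= m <= n / d) spt(n - d m, N) + [d | n] n / d,
   since these parts only affect the multiplicity of the smallest part when
   the partition consists of nothing else.  As spt(n, 1) = n, the asymptotics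
   follow by induction on N: by telescoping, the sum of (n - d m)^N is
   n^(N+1) / (d (N + 1)) + O(n^N), and the correction term is O(n). *)

Definition smallest_mult (s : seq nat) : nat := count_mem (smallest_part s) s.

(** Grouping by the multiplicity [m] of the largest allowed part lets the recurrence for [spt] be
    read off the enumeration. *)
Fixpoint partitions_seq (N n : nat) : seq (seq nat) :=
  if N is N'.+1 then
    [seq nseq m N ++ s | m <- iota 0 (n %/ N).+1,
                         s <- partitions_seq N' (n - N * m)]
  else if n == 0%N then [:: [::]] else [::].

Lemma partitions_seqS (N n : nat) :
  partitions_seq N.+1 n
    = [seq nseq m N.+1 ++ s | m <- iota 0 (n %/ N.+1).+1,
                              s <- partitions_seq N (n - N.+1 * m)].
Proof. by []. Qed.

Lemma geq_trans : transitive geq.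
Proof. by move=> b a c ab bc; apply: leq_trans bc ab. Qed.

Lemma sorted_nseq_cat (m d : nat) (s : seq nat) :
  all (leq^~ d) s -> sorted geq (nseq m d ++ s) = sorted geq s.
Proof.
move=> s_le; elim: m => //= m IHm.
rewrite (path_sortedE geq_trans) all_cat s_le andbT IHm.
by rewrite all_nseq /= leqnn orbT.
Qed.

Lemma nseq_cat_decomp (d : nat) (s : seq nat) :
  sorted geq s -> all (leq^~ d.+1) s ->
  exists m t, s = nseq m d.+1 ++ t /\ all (leq^~ d) t.
Proof.
elim: s => [|a s IHs] /=; first by exists 0%N, [::].
move=> ss /andP[a_le s_le].
have [a_d|a_nd] := eqVneq a d.+1.
  have [m [t [-> t_le]]] := IHs (path_sorted ss) s_le.
  by exists m.+1, t; rewrite a_d.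
exists 0%N, (a :: s); split=> //=.
have ad : (a <= d)%N by rewrite -ltnS ltn_neqAle a_nd.
rewrite ad /=; move: ss; rewrite (path_sortedE geq_trans) => /andP[sa _].
by apply: sub_all sa => x /= xa; apply: leq_trans ad.
Qed.

Lemma is_partition_nseq_cat (m d n : nat) (s : seq nat) :
  all (leq^~ d) s ->
  is_partition n (nseq m d.+1 ++ s)
    = (d.+1 * m <= n)%N && is_partition (n - d.+1 * m) s.
Proof.
move=> s_le; rewrite /is_partition sorted_nseq_cat; last first.
  by apply: sub_all s_le => x /leqW.
rewrite all_cat all_nseq /= orbT /= sumn_cat sumn_nseq.
case: sorted => /=; last by rewrite andbF.
case: all => /=; last by rewrite andbF.
by apply/idP/idP; lia.
Qed.

Lemma mem_partitions_seq (N n : nat) (s : seq nat) :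
  (s \in partitions_seq N n) = is_partition n s && all (leq^~ N) s.
Proof.
elim: N n s => [|N IHN] n s.
  rewrite /=; case: s => [|a s]; first by case: n.
  have -> : a :: s \in (if n == 0%N then [:: [::]] else [::]) = false.
    by case: ifP; rewrite ?inE.
  by case: a => [|a]; rewrite /is_partition /= ?andbF.
apply/allpairsPdep/andP => [[m [t [m_le]]]|[s_part s_le]].
  rewrite IHN => /andP[t_part t_le] ->.
  have le_mn : (N.+1 * m <= n)%N.
    by move: m_le; rewrite mem_iota add0n ltnS leq_divRL// mulnC.
  rewrite is_partition_nseq_cat// le_mn t_part all_cat all_nseq leqnn orbT.
  by split=> //=; apply: sub_all t_le => x /leqW.
have /and3P[ss _ _] := s_part.
have [m [t [s_eq t_le]]] := nseq_cat_decomp _ _ ss s_le.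
move: s_part; rewrite s_eq is_partition_nseq_cat// => /andP[le_mn t_part].
exists m, t; rewrite IHN t_part t_le; split=> //.
by rewrite mem_iota add0n ltnS leq_divRL// mulnC.
Qed.

Lemma uniq_partitions_seq (N n : nat) : uniq (partitions_seq N n).
Proof.
elim: N n => [|N IHN] n; first by rewrite /=; case: eqP.
apply: allpairs_uniq_dep => [||u v]; [exact: iota_uniq | by move=> m _ |].
move=> /allpairsPdep[m [s [_ s_in ->]]] /allpairsPdep[m' [s' [_ s'_in ->]]] /=.
(* The multiplicity is recovered as the count of [N.+1], since no entry of [t] reaches that value;
   hence blocks with different [m] are disjoint. *)
have cnt k t j : t \in partitions_seq N j ->
    count_mem N.+1 (nseq k N.+1 ++ t) = k.
  rewrite mem_partitions_seq => /andP[_ /allP t_le].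
  rewrite count_cat count_nseq /= eqxx mul1n (count_memPn _) ?addn0//.
  by apply/negP => /t_le; rewrite /= ltnn.
move=> eq_ss; have := congr1 (count_mem N.+1) eq_ss.
rewrite (cnt _ _ _ s_in) (cnt _ _ _ s'_in) => eq_m; subst m'.
by move/eqP: eq_ss; rewrite eqseq_cat// eqxx => /eqP->.
Qed.

Lemma spt_partitions_seq (n N : nat) :
  spt n N = (\sum_(s <- partitions_seq N n) smallest_mult s)%N.
Proof.
rewrite /spt -big_enum /=.
rewrite -(big_map (fun p : n.-bseq 'I_n.+1 => map val p) xpredT smallest_mult).
apply: perm_big; apply: uniq_perm; last first.
- move=> s; rewrite mem_partitions_seq; apply/mapP/andP => [[p]|[s_part s_le]].
    by rewrite mem_enum inE => /andP[p_part p_le] ->; rewrite all_map.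
  have [p ps] := is_partition_bseq s_part.
  exists p => //; rewrite mem_enum inE ps s_part /=.
  by move: s_le; rewrite -ps all_map.
- exact: uniq_partitions_seq.
rewrite map_inj_uniq ?enum_uniq// => p q /inj_map pq.
by apply/val_inj/pq/val_inj.
Qed.

(** If [s] is nonempty, its last entry is also that of the whole list and lies below [d.+1], so the
    prefix is not counted. If [s] is empty, all [m] copies are. *)
Lemma smallest_mult_nseq_cat (m d : nat) (s : seq nat) :
  all (leq^~ d) s ->
  smallest_mult (nseq m d.+1 ++ s) = (smallest_mult s + m * (s == [::]))%N.
Proof.
rewrite /smallest_mult /smallest_part; case: s => [_|a s s_le].
  rewrite cats0 muln1 /=; case: m => // m.
  have -> : last 0%N (nseq m.+1 d.+1) = d.+1 by elim: m.
  by rewrite count_nseq /= eqxx mul1n.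
rewrite muln0 addn0 last_cat count_cat count_nseq /=.
have /allP/(_ _ (mem_last a s))/= := s_le.
by case: eqP => // <-; rewrite ltnn.
Qed.

Lemma spt0 (n : nat) : spt n 0 = 0%N.
Proof.
rewrite spt_partitions_seq /=.
by case: eqP => _; rewrite ?big_nil// big_seq1.
Qed.

Lemma sptS (n N : nat) :
  spt n N.+1 = (\sum_(m < (n %/ N.+1).+1) spt (n - N.+1 * m) N
                + n %/ N.+1 * (N.+1 %| n))%N.
Proof.
rewrite spt_partitions_seq partitions_seqS big_allpairs_dep.
transitivity (\sum_(m <- iota 0 (n %/ N.+1).+1)
    (spt (n - N.+1 * m) N + m * (n - N.+1 * m == 0)))%N.
  apply: eq_bigr => m _; rewrite spt_partitions_seq.
  rewrite [LHS]big_seq.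
  rewrite [LHS](eq_bigr (fun s => smallest_mult s + m * (s == [::]))%N).
    rewrite -big_seq big_split /= -big_distrr /=; congr (_ + m * _)%N.
    (* The enumeration has no repetitions, so summing the indicator of [[::]] tests whether the
       empty partition occurs, that is, whether the remainder is 0. *)
    have -> : (n - N.+1 * m == 0)%N
        = ([::] \in partitions_seq N (n - N.+1 * m)).
      by rewrite mem_partitions_seq andbT /is_partition /= eq_sym.
    rewrite -count_uniq_mem ?uniq_partitions_seq// -sum1_count.
    by rewrite [RHS]big_mkcond; apply: eq_bigr => s _ /=; case: eqP.
  move=> s; rewrite mem_partitions_seq => /andP[_].
  exact: smallest_mult_nseq_cat.
rewrite -[X in iota 0 X]subn0 -/(index_iota 0 _) big_split !big_mkord.
congr addn.
(* Only the last index [n %/ N.+1] can exhaust [n], and it does so exactly when [N.+1] divides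
   [n]. *)
rewrite big_ord_recr big1 /= ?add0n; last first.
  move=> [m /= m_lt] _; apply/eqP; rewrite muln_eq0 eqb0; apply/orP; right.
  by move: m_lt; rewrite leq_divRL//; lia.
rewrite subn_eq0 [in RHS]dvdn_eq eqn_leq leq_trunc_div.
by rewrite [(_ %/ _ * N.+1)%N]mulnC.
Qed.

(** A mean value inequality for [z ^+ k.+1], kept algebraic: the induction splits off one factor [y]
    and the term [x ^+ k.+1 * (y - x)]. *)
Lemma expr_diff_bounds (R : realFieldType) (k : nat) (x y : R) :
  0 <= x -> x <= y ->
  k.+1%:R * x ^+ k * (y - x) <= y ^+ k.+1 - x ^+ k.+1
    <= k.+1%:R * y ^+ k * (y - x).
Proof.
move=> x_ge0 le_xy; have y_ge0 : 0 <= y by exact: le_trans le_xy.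
elim: k => [|k /andP[IHl IHu]]; first by rewrite !expr0 !expr1 !mul1r lexx.
have -> : y ^+ k.+2 - x ^+ k.+2
    = y * (y ^+ k.+1 - x ^+ k.+1) + x ^+ k.+1 * (y - x).
  by rewrite (exprS y k.+1) (exprS x k.+1); ring.
have split_c z : k.+2%:R * z ^+ k.+1 * (y - x)
    = z * (k.+1%:R * z ^+ k * (y - x)) + z ^+ k.+1 * (y - x).
  by rewrite -(natr1 k.+1) (exprS z k); ring.
have le_exp : x ^+ k.+1 <= y ^+ k.+1 by exact: lerXn2r.
have diff_ge0 : 0 <= y ^+ k.+1 - x ^+ k.+1 by rewrite subr_ge0.
rewrite !split_c; apply/andP; split; apply: lerD => //.
- by apply: le_trans (ler_wpM2r diff_ge0 le_xy); apply: ler_wpM2l.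
- by apply: ler_wpM2l.
- by apply: ler_wpM2r => //; rewrite subr_ge0.
Qed.

(** The terms are the [k]-th powers of [r], [r + d], ..., [r + d * M]. When the top moves from [x]
    to [x + d], the sum gains [(x + d) ^+ k] and the quotient gains between [x ^+ k] and
    [(x + d) ^+ k]. So the error grows by at least 0 and at most [(x + d) ^+ k - x ^+ k], which
    telescopes. *)
Lemma arith_progression_sum_expr (R : realFieldType) (k d r M : nat) :
  (0 < d)%N -> (r <= d)%N ->
  0 <= \sum_(m < M.+1) ((r + d * M - d * m)%:R : R) ^+ k
       - (r + d * M)%:R ^+ k.+1 / (d%:R * k.+1%:R)
    <= (r + d * M)%:R ^+ k.
Proof.
move=> d_gt0 le_rd.
have d_gt0R : 0 < d%:R :> R by rewrite ltr0n.
have c_gt0 : 0 < d%:R * k.+1%:R :> R by rewrite mulr_gt0.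
elim: M => [|M /andP[IHl IHu]].
  rewrite big_ord1 !muln0 addn0 subn0.
  have r_ge0 : 0 <= r%:R ^+ k :> R by rewrite exprn_ge0.
  (* The single term [r ^+ k] dominates the quotient because [r <= d <= d * k.+1]. *)
  rewrite subr_ge0 ler_pdivrMr// exprSr ler_wpM2l//=; last first.
    by rewrite -natrM ler_nat; apply: leq_trans le_rd _; apply: leq_pmulr.
  by rewrite gerBl divr_ge0// ?mulr_ge0// ?exprn_ge0.
(* Index 0 carries the new, largest term; the others form the sum for [M]. *)
rewrite big_ord_recl muln0 subn0.
rewrite (eq_bigr (fun m : 'I_M.+1 => (r + d * M - d * m)%:R ^+ k)); last first.
  by move=> m _; congr (_%:R ^+ _); rewrite /= /bump; lia.
move: IHl IHu; set S := \sum_(_ < _) _.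
have -> : (r + d * M.+1 = r + d * M + d)%N by lia.
set x := (r + d * M)%N => IHl IHu.
have le_x : x%:R <= (x + d)%:R :> R by rewrite ler_nat leq_addr.
have /andP[] := @expr_diff_bounds R k _ _ (ler0n _ _) le_x.
have -> : (x + d)%:R - x%:R = d%:R :> R by rewrite natrD addrAC subrr add0r.
have mulc z : k.+1%:R * z * d%:R = z * (d%:R * k.+1%:R) :> R by ring.
rewrite !mulc -(ler_pdivrMr _ _ c_gt0) -(ler_pdivlMr _ _ c_gt0) !mulrBl.
move: IHl IHu; move: (_ ^+ k.+1 / _) (_ ^+ k.+1 / _) (_ ^+ k) (_ ^+ k) S.
by move=> u v w z S ? ? ? ?; apply/andP; split; lra.
Qed.

Lemma spt1 (n : nat) : spt n 1 = n.
Proof. by rewrite sptS big1 => [|m _]; rewrite ?spt0// divn1 dvd1n muln1. Qed.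

(** Using [n.+1] makes the bound uniform in [n], including [n = 0], and absorbs the at most [n.+1]
    summands of the recurrence. Each induction step raises [C] by 2: 1 for the power sum error and 1
    for the divisibility term. *)
Lemma spt_bound (R : realFieldType) (N : nat) :
  exists C : R, 0 <= C /\ forall n : nat,
    `|(spt n N.+1)%:R - n%:R ^+ N.+1 / (N.+1`!)%:R ^+ 2| <= C * n.+1%:R ^+ N.
Proof.
elim: N => [|N [C [C_ge0 IHN]]].
  by exists 0; split=> // n; rewrite spt1 expr1 expr1n divr1 subrr normr0 mul0r.
exists (C + 2); split=> [|n]; first by rewrite addr_ge0.
rewrite sptS; set d := N.+2; set M := (n %/ d)%N.
set e := (M * _)%N; pose a : R := (N.+1`!)%:R ^- 2.
have fact_gt0R : 0 < (N.+1`!)%:R :> R by rewrite ltr0n fact_gt0.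
have a_ge0 : 0 <= a by rewrite invr_ge0 exprn_ge0.
have a_le1 : a <= 1.
  by rewrite invf_le1 ?exprn_gt0// -natrX ler1n expn_gt0 fact_gt0.
have le_Mn : (M <= n)%N by exact: leq_div.
have e_le : (e <= n)%N by rewrite /e; case: (d %| n)%N; lia.
have n_eq : (n %% d + d * M = n)%N by rewrite addnC mulnC -divn_eq.
have mod_le : (n %% d <= d)%N by exact/ltnW/ltn_pmod.
have /andP[] := arith_progression_sum_expr R N.+1 d (n %% d)%N M isT mod_le.
rewrite n_eq; set T := \sum_(_ < _) _; set g := _ / _ => Tl Tu.
(* The step [d] of the progression is also the new exponent, so [g] is [n ^ d / d ^ 2], and [a]
   supplies the rest of the squared factorial. *)
have -> : n%:R ^+ d / (d`!)%:R ^+ 2 = a * g.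
  rewrite /a /g /d factS natrM; field.
  by rewrite -natrD (gt_eqF fact_gt0R) pnatr_eq0.
rewrite natrD natr_sum.
have sum_le : `|\sum_(m < M.+1) (spt (n - d * m) N.+1)%:R - a * T|
    <= C * n.+1%:R ^+ N.+1.
  rewrite mulr_sumr -sumrB; apply: le_trans (ler_norm_sum _ _ _) _.
  apply: le_trans (_ : \sum_(m < M.+1) C * n.+1%:R ^+ N <= _).
    apply: ler_sum => m _; rewrite [a * _]mulrC.
    apply: le_trans (IHN _) _; apply: ler_wpM2l => //.
    by apply: lerXn2r; rewrite ?nnegrE// ler_nat ltnS leq_subr.
  rewrite sumr_const card_ord -[_ *+ M.+1]mulr_natr -mulrA ler_wpM2l// exprSr.
  by rewrite ler_wpM2l ?exprn_ge0// ler_nat.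
have pow_le : n%:R ^+ N.+1 <= n.+1%:R ^+ N.+1 :> R.
  by apply: lerXn2r; rewrite ?nnegrE// ler_nat.
have n_le : n%:R <= n.+1%:R ^+ N.+1 :> R.
  rewrite -natrX ler_nat; apply: leq_trans (leqnSn n) _.
  by rewrite expnS leq_pmulr ?expn_gt0.
have aT_le : a * (T - g) <= n.+1%:R ^+ N.+1.
  by rewrite -[leRHS]mul1r ler_pM// (le_trans Tu).
have aT_ge : 0 <= a * (T - g) by rewrite mulr_ge0.
have e_leR : e%:R <= n.+1%:R ^+ N.+1 :> R.
  by apply: le_trans n_le; rewrite ler_nat.
have e_ge0 : 0 <= e%:R :> R by [].
move: sum_le aT_le aT_ge; rewrite mulrBr !ler_norml => /andP[? ?] ? ?.
by apply/andP; split; lra.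
Qed.

Theorem theorem2p6 (R : realType) (N : nat) (hN : (0 < N)%N) :
  (fun n : nat => (spt n N)%:R : R)
    = (fun n : nat => n%:R ^+ N / (N`!)%:R ^+ 2)
      +O_\oo (fun n : nat => (n%:R : R) ^+ N.-1).
Proof.
case: N hN => // N _ /=; apply/eqaddOP.
have [C [C_ge0 bound]] := spt_bound R N.
(* The constant [k] is taken at least [C * 2 ^+ N], where the 2 comes from [n.+1 <= 2 * n] for
   positive [n]. *)
near=> k; near=> n.
have n_gt0 : (0 < n)%N by near: n; exact: nbhs_infty_ge.
apply: le_trans (bound n) _.
apply: le_trans (_ : C * (2 * n%:R) ^+ N <= _).
  apply: ler_wpM2l => //; apply: lerXn2r; rewrite ?nnegrE// -natrM ler_nat; lia.
by rewrite exprMn mulrA ger0_norm ?exprn_ge0// ler_wpM2r ?exprn_ge0//.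
Unshelve. all: by end_near.
Qed.
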